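(* Let $\alpha\in(0,1)$, let $\{P(t)\}_{t\ge 0}$ be a bounded continuous semigroup on a Banach space with generator $L_x$, and let $f\in D(L_x)$, the domain of the generator. Then the unique solution of the Cauchy problem with conformable time derivative $$T_\alpha u(t,x)=L_x u(t,x),\quad t>0;\qquad u(0,x)=f(x),$$ is given by $$u(t,x)=P(t^\alpha/\alpha)f(x).$$ In particular, if the semigroup is a Markov semigroup of the form $P(t)f(x)=E_x[f(X_t)]$ for a process $X_t$, then $u(t,x)=E_x[f(X_{t^\alpha/\alpha})]$.
   Context: Conformable derivative: for $\alpha\in(0,1)$, a function $g$ on $[0,\infty)$ and $t>0$, $T_\alpha(g)(t)=\lim_{\varepsilon\to 0}\frac{g(t+\varepsilon t^{1-\alpha})-g(t)}{\varepsilon}$; here $T_\alpha$ acts in the variable $t$, and for Banach-space-valued functions the limit is in norm. Continuous semigroup means strongly continuous ($C_0$) semigroup; bounded means $\sup_{t\ge0}\|P(t)\|<\infty$. The generator is $L_xg=\lim_{t\to0^+}(P(t)g-g)/t$ in norm, with domain $D(L_x)$ the set of $g$ for which the limit exists. The notation $u(t,x)$ stands for the Banach-space-valued function $t\mapsto u(t,\cdot)$. A solution is a continuous map $t\mapsto u(t,\cdot)$ from $[0,\infty)$ to the Banach space with $u(0,\cdot)=f$ such that, for every $t>0$, $u(t,\cdot)\in D(L_x)$, the limit defining $T_\alpha u(t,\cdot)$ exists, and it equals $L_xu(t,\cdot)$. $E_x$ denotes expectation for the process started at $x$. *)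

(* Defs.v *)
From HB Require Import structures.
From mathcomp Require Import all_boot all_order all_algebra.
From mathcomp Require Import all_classical all_reals all_analysis.
Set Implicit Arguments.
Unset Strict Implicit.
Unset Printing Implicit Defensive.
Import Order.TTheory GRing.Theory Num.Theory.
Import numFieldNormedType.Exports.
Local Open Scope classical_set_scope.
Local Open Scope ring_scope.

(* Functions of the time variable are total on R; only their values on
   [0, +oo[ are constrained or used. *)

Section semigroups.
Context {R : realType} {V : completeNormedModType R}.
Implicit Types (P : R -> V -> V) (g f : V) (u : R -> V).

Record c0_semigroup P : Prop := {
  c0_linear : forall t : R, 0 <= t -> linear (P t) ;
  c0_continuous : forall t : R, 0 <= t -> continuous (P t) ;
  c0_id : forall g, P 0 g = g ;
  c0_add : forall s t : R, 0 <= s -> 0 <= t -> forall g, P (s + t) g = P s (P t g) ;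
  c0_strong : forall g, P t g @[t --> 0^'+] --> g }.

Definition opnorm (A : V -> V) : \bar R :=
  ereal_sup [set `|A g|%:E | g in [set g | `|g| <= 1]].

Definition bounded_semigroup P : Prop :=
  (ereal_sup [set opnorm (P t) | t in [set t | 0 <= t]%R] < +oo)%E.

Definition generator_domain P : set V :=
  [set g | cvg (t^-1 *: (P t g - g) @[t --> 0^'+])].

(* Meaningful only on [generator_domain P]: [lim] is total. *)
Definition generator P g : V := lim (t^-1 *: (P t g - g) @[t --> 0^'+]).

Definition conformable_quotient (alpha : R) u (t eps : R) : V :=
  eps^-1 *: (u (t + eps * t `^ (1 - alpha)) - u t).

Definition conformable_derivable (alpha : R) u (t : R) : Prop :=
  cvg (conformable_quotient alpha u t eps @[eps --> 0^']).

(* Meaningful only when [conformable_derivable alpha u t]. *)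
Definition conformable_derive (alpha : R) u (t : R) : V :=
  lim (conformable_quotient alpha u t eps @[eps --> 0^']).

Record conformable_solution (alpha : R) P f u : Prop := {
  csol_continuous : {within `[0, +oo[, continuous u} ;
  csol_init : u 0 = f ;
  csol_domain : forall t : R, 0 < t -> generator_domain P (u t) ;
  csol_derivable : forall t : R, 0 < t -> conformable_derivable alpha u t ;
  csol_eq : forall t : R, 0 < t ->
    conformable_derive alpha u t = generator P (u t) }.

End semigroups.

Section markov.
Context {R : realType} {V : completeNormedModType R}.
Context {d : measure_display} {E : measurableType d}.

(* The elements of V are measurable real functions on the state space E with
   pointwise operations, [ev g x] being the value of g at x. *)
Record function_space (ev : V -> E -> R) : Prop := {
  ev_linear : forall (a : R) (g h : V) (x : E),
    ev (a *: g + h) x = a * ev g x + ev h x ;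
  ev_inj : injective ev ;
  ev_measurable : forall g, measurable_fun setT (ev g) }.

(* Constants need not belong to V, for instance when V is a space of functions
   vanishing at infinity; hence both of the last two fields. *)
Record markov_semigroup (ev : V -> E -> R) (P : R -> V -> V) : Prop := {
  markov_ge0 : forall t : R, 0 <= t -> forall g,
    (forall x, 0 <= ev g x) -> forall x, 0 <= ev (P t g) x ;
  markov_le1 : forall t : R, 0 <= t -> forall g,
    (forall x, ev g x <= 1) -> forall x, ev (P t g) x <= 1 ;
  markov_one : forall t : R, 0 <= t -> forall e,
    (forall x, ev e x = 1) -> P t e = e }.

(* [Pr x] is the law under which the process X starts at x.  As the left-hand
   side of [process_repr] is finite and [ev g] is measurable, that field entails
   the integrability of [ev g \o X t] under [Pr x]. *)
Record process_semigroup (ev : V -> E -> R) (P : R -> V -> V)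
    {d' : measure_display} {Omega : measurableType d'}
    (Pr : E -> probability Omega R) (X : R -> {mfun Omega >-> E}) : Prop := {
  process_start : forall x, {ae Pr x, forall w, X 0 w = x} ;
  process_repr : forall t : R, 0 <= t -> forall g x,
    (ev (P t g) x)%:E = ('E_(Pr x)[ev g \o X t])%E }.

End markov.

(* Main.v *)
Require Import Defs.
From HB Require Import structures.
From mathcomp Require Import all_boot all_order all_algebra.
From mathcomp Require Import all_classical all_reals all_analysis.
Import Order.TTheory GRing.Theory Num.Theory.
Import numFieldNormedType.Exports.
Local Open Scope classical_set_scope.
Local Open Scope ring_scope.

(** The conformable derivative is an ordinary derivative in disguise: the
    increment of [u] at [t] along [eps * t `^ (1 - alpha)] rescales, so that for
    [t > 0] one has [T_alpha u (t) = t `^ (1 - alpha) *: u' t]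
    ([cvg_conformable_quotient]).  The clock [phi t = t `^ alpha / alpha] solves
    [phi' t = t `^ (alpha - 1)] with [phi 0 = 0], hence reading an orbit
    [s |-> P s f], whose derivative is [generator P (P s f)], at time [phi t]
    gives a solution by the chain rule.

    Uniqueness is the classical argument for the abstract Cauchy problem, run
    along this clock.  For a solution [u] and a final time [T], consider
    [w s = P (phi T - phi s) (u s)] on [[0, T]].  Moving [s] forward makes [u]
    grow at the rate [phi' s *: generator P (u s)] and takes the same amount off
    the semigroup time, so the two contributions to [w'] cancel
    ([is_derive_reversed_clock]).  A curve with zero derivative is constant
    ([is_derive1_eq0_cst]), and comparing [w T = u T] with [w 0 = P (phi T) f]
    identifies [u].

    The analytic input is the joint continuity of [(r, g) |-> P r g]
    ([cvg_semigroup]), a consequence of the uniform bound on the semigroup and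
    of its strong continuity at [0]; it upgrades the right derivative at [0]
    that defines the generator to a two-sided derivative of orbits
    ([is_derive_orbit]) and yields the product rule for [w].

    For a process the semigroup is by definition the expectation, so the
    probabilistic formula is the representation of [P (phi t) f]. *)

(** * Curves in a normed space *)

Section curves.
Context {R : realType}.

Lemma cvg_addr_dnbhs0 (t : R) : h + t @[h --> 0^'] --> t.
Proof.
apply: cvg_within_filter; rewrite -[in X in _ --> X](add0r t).
by apply: cvgD; [exact: cvg_id|exact: cvg_cst].
Qed.

Lemma cvg_scale_dnbhs0 (c : R) : c != 0 -> h * c @[h --> 0^'] --> 0^'.
Proof.
move=> c0 A /= [e e0 eA]; exists (e / `|c|) => /=.
  by rewrite divr_gt0 // normr_gt0.
move=> h /=; rewrite sub0r normrN => he h0; apply: eA => /=.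
  by rewrite sub0r normrN normrM -ltr_pdivlMr// normr_gt0.
by rewrite mulf_neq0.
Qed.

Lemma is_derive1P {V : normedModType R} (w : R -> V) (t : R) (l : V) :
  is_derive t 1 w l <-> h^-1 *: (w (h + t) - w t) @[h --> 0^'] --> l.
Proof.
have E : (fun h : R => h^-1 *: ((w \o shift t) (h *: (1 : R)) - w t)) =
         (fun h : R => h^-1 *: (w (h + t) - w t)).
  by apply/funext => h /=; rewrite [h *: _]mulr1.
split=> [[dw <-]|wl].
  by rewrite -E; exact: dw.
apply: DeriveDef; first by rewrite /derivable E; exact: cvgP wl.
by rewrite /derive E; exact: cvg_lim wl.
Qed.

Lemma is_derive1_cvg {V : normedModType R} {w : R -> V} {t : R} {l : V} :
  is_derive t 1 w l -> w x @[x --> t] --> w t.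
Proof.
by move=> [dw _]; apply: differentiable_continuous; exact/derivable1_diffP.
Qed.

(** Chain rule for a real reparametrization of a vector-valued curve, in the form
    that gives the derivative as a scalar multiple. *)
Lemma is_derive1_comp_curve {V : normedModType R} (w : R -> V) (phi : R -> R)
    (t a : R) (l : V) :
  is_derive (phi t) 1 w l -> is_derive t 1 phi a ->
  is_derive t 1 (w \o phi) (a *: l).
Proof.
move=> [dw wl] [dphi phia].
have dw' : differentiable w (phi t) by exact/derivable1_diffP.
have dphi' : differentiable phi t by exact/derivable1_diffP.
apply: DeriveDef; first exact/derivable1_diffP/differentiable_comp.
rewrite deriveE; last exact: differentiable_comp.
rewrite diff_comp //= -(deriveE (1 : R^o) dphi') phia.
by rewrite diff1E // derive1E wl.
Qed.

(** The mean value theorem, being an equality, holds for real functions and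
    fails for vector-valued ones.  The real function [x |-> `|w x - w a|] reduces this
    lemma to it: by the reverse triangle inequality its increments are dominated
    by those of [w], so its derivative vanishes as well. *)
Lemma is_derive1_eq0_cst {V : normedModType R} (w : R -> V) {a b : R} : a < b ->
  (forall x, x \in `]a, b[ -> is_derive x 1 w 0) ->
  {within `[a, b], continuous w} -> w b = w a.
Proof.
move=> ab dw cw; pose n x := `|w x - w a|.
have dn x : x \in `]a, b[ -> is_derive x 1 n 0.
  move=> /dw/is_derive1P/norm_cvg0P dwx; apply/is_derive1P/norm_cvg0P.
  apply: squeeze_cvgr (cvg_cst 0) dwx; near=> h.
  rewrite normr_ge0 /= !normrZ ler_wpM2l // /n.
  by rewrite (le_trans (ler_dist_dist _ _))// opprB addrA subrK.
have cn : {within `[a, b], continuous n}.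
  by move=> x; apply: cvg_norm; apply: cvgB; [exact: cw|exact: cvg_cst].
have [c _] := MVT ab dn cn.
by rewrite mul0r /n subrr normr0 subr0 => /eqP; rewrite normr_eq0 subr_eq0 => /eqP.
Unshelve. all: by end_near. Qed.

(** Replacing the increment [e * t `^ (1 - alpha)] by [h] turns one difference
    quotient into the other, up to the factor [t `^ (1 - alpha)]; this factor is
    nonzero because [t > 0], so the equivalence goes both ways. *)
Lemma cvg_conformable_quotient {V : completeNormedModType R} (alpha : R)
    (w : R -> V) (t : R) (l : V) : 0 < t ->
  conformable_quotient alpha w t e @[e --> 0^'] --> t `^ (1 - alpha) *: l <->
  is_derive t 1 w l.
Proof.
set c := t `^ (1 - alpha) => t0.
have c0 : c != 0 by rewrite gt_eqF // powR_gt0.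
split=> [Ql|/is_derive1P Dl].
  apply/is_derive1P; rewrite -[l](scalerK c0).
  rewrite (_ : (fun h => _) =
      (fun h => c^-1 *: conformable_quotient alpha w t (h * c^-1))); last first.
    apply/funext => h; rewrite /conformable_quotient -/c mulfVK // scalerA.
    by rewrite invfM invrK mulrCA mulVf // mulr1 [t + h]addrC.
  apply: cvgZr; apply: cvg_comp Ql; apply: cvg_scale_dnbhs0.
  by rewrite invr_eq0.
rewrite (_ : conformable_quotient alpha w t =
    (fun e => c *: ((e * c)^-1 *: (w (e * c + t) - w t)))); last first.
  apply/funext => e; rewrite /conformable_quotient -/c scalerA.
  by rewrite invfM mulrCA mulfV // mulr1 [t + _]addrC.
by apply: cvgZr; apply: cvg_comp Dl; exact: cvg_scale_dnbhs0.
Qed.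

End curves.

(** * Bounded strongly continuous semigroups *)

Section semigroup.
Context {R : realType} {V : completeNormedModType R}.
Context (P : R -> V -> V) (P_c0 : c0_semigroup P) (P_bounded : bounded_semigroup P).
Implicit Types (g : V) (s t : R).

Lemma semigroupZ t (a : R) g : 0 <= t -> P t (a *: g) = a *: P t g.
Proof.
move=> t0; have lP := c0_linear P_c0 t0.
have P0 : P t 0 = 0.
  by have := lP (-1) 0 0; rewrite scaler0 addr0 scaleN1r addNr.
by rewrite -[a *: g]addr0 lP P0 addr0.
Qed.

Lemma semigroupB t g h : 0 <= t -> P t (g - h) = P t g - P t h.
Proof.
move=> t0; rewrite addrC -scaleN1r (c0_linear P_c0 t0) scaleN1r.
by rewrite addrC.
Qed.

(** The boundedness hypothesis is a supremum in the extended reals over the unit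
    ball; homogeneity makes it an estimate at every vector. *)
Lemma semigroup_bound :
  exists2 M : R, 0 < M & forall t, 0 <= t -> forall g, `|P t g| <= M * `|g|.
Proof.
have [K Kub] : exists K : R, forall t, 0 <= t -> forall g, `|g| <= 1 -> `|P t g| <= K.
  have ub t g : 0 <= t -> `|g| <= 1 ->
      (`|P t g|%:E <= ereal_sup [set opnorm (P t) | t in [set t | 0 <= t]%R])%E.
    move=> t0 g1; apply: (@le_trans _ _ (opnorm (P t))).
      by apply: ereal_sup_ubound; exists g.
    by apply: ereal_sup_ubound; exists t.
  move: P_bounded ub; rewrite /bounded_semigroup.
  (* A supremum of -oo is excluded by the nonnegative norm of [P 0 0]. *)
  case: (ereal_sup _) => [K _ ub|//|_ ub].
    by exists K => t t0 g g1; rewrite -lee_fin ub.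
  have := ub 0 0 (lexx _); rewrite normr0 ler01 => /(_ isT).
  by rewrite leeNy_eq.
(* The maximum with [1] makes the constant positive, so that one can divide by
   it. *)
exists (Num.max K 1) => [|t t0 g]; first by rewrite lt_max ltr01 orbT.
have [->|g0] := eqVneq g 0.
  by rewrite -[0](scale0r 0) semigroupZ // !scale0r !normr0 mulr0.
have ng : 0 < `|g| by rewrite normr_gt0.
have : `|P t (`|g|^-1 *: g)| <= Num.max K 1.
  rewrite le_max Kub //.
  by rewrite normrZ normfV normr_id mulVf // gt_eqF.
by rewrite semigroupZ // normrZ normfV normr_id mulrC ler_pdivrMr.
Qed.

(** Factoring out the smaller of the two times controls the variation of an
    orbit, uniformly, by its variation at time [0].  The absolute value makes
    the estimate symmetric, so that it gives continuity from both sides out of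
    the continuity from the right at [0]. *)
Lemma semigroup_dist (M : R) :
  (forall t, 0 <= t -> forall g, `|P t g| <= M * `|g|) ->
  forall s t g, 0 <= s -> 0 <= t -> `|P s g - P t g| <= M * `|P `|s - t| g - g|.
Proof.
move=> PM; have sub s t g : 0 <= t -> t <= s ->
    `|P s g - P t g| <= M * `|P `|s - t| g - g|.
  move=> t0 ts; rewrite ger0_norm ?subr_ge0 //.
  have -> : P s g = P t (P (s - t) g).
    by rewrite -(c0_add P_c0) ?subr_ge0 // addrC subrK.
  by rewrite -semigroupB // PM.
move=> s t g s0 t0; have [ts|/ltW st] := leP t s; first exact: sub.
by rewrite distrC (distrC s); exact: sub.
Qed.

(** Joint continuity in time and vector: split
    [P r u - P r0 u0 = P r (u - u0) + (P r u0 - P r0 u0)] and bound the first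
    term uniformly in [r].  It is stated along an arbitrary filter because it
    serves for difference quotients at [0^'] and [0^'+] as well as for
    continuity inside and at the ends of an interval; the times only have to be
    nonnegative eventually. *)
Lemma cvg_semigroup {T : Type} {F : set_system T} {FF : Filter F}
    (r : T -> R) (u : T -> V) (r0 : R) (u0 : V) :
  0 <= r0 -> (\forall x \near F, 0 <= r x) ->
  r x @[x --> F] --> r0 -> u x @[x --> F] --> u0 ->
  P (r x) (u x) @[x --> F] --> P r0 u0.
Proof.
move=> r00 rge0 rr0 uu0; have [M M0 PM] := semigroup_bound.
have Pu0 : P `|h| u0 - u0 @[h --> (0 : R)] --> (0 : V).
  rewrite -(subrr u0); apply: cvgB; last exact: cvg_cst.
  have Pu : P t u0 @[t --> 0^'+] --> u0 by exact: c0_strong.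
  move=> A Au; have [e /= e0 eA] := Pu A Au.
  exists e => //= h /=; rewrite sub0r normrN => he.
  have [->|h0] := eqVneq h 0.
    by rewrite /= normr0 (c0_id P_c0); exact: nbhs_singleton.
  by apply: eA => /=; rewrite ?sub0r ?normrN ?normr_id // normr_gt0.
apply/cvgrPdist_lt => e e0.
have e20 : 0 < e / M / 2 by rewrite !divr_gt0.
have dr : `|P `|r x - r0| u0 - u0| @[x --> F] --> (0 : R).
  apply/norm_cvg0P; apply: cvg_comp Pu0.
  by rewrite -(subrr r0); apply: cvgB => //; exact: cvg_cst.
near=> x.
have rx : 0 <= r x by near: x.
rewrite distrC -(subrK (P (r x) u0) (P (r x) (u x))) -addrA.
rewrite (le_lt_trans (ler_normD _ _))//.
rewrite -semigroupB //.
rewrite (le_lt_trans (lerD (PM _ rx _) (@semigroup_dist M PM _ _ u0 rx r00)))//.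
rewrite -mulrDr -ltr_pdivlMl // mulrC [ltRHS]splitr ltrD //.
  by rewrite distrC; near: x; apply: cvgr_dist_lt.
by near: x; apply: (cvgr_lt 0).
Unshelve. all: by end_near. Qed.

(** [P t] commutes with the difference quotients at [0], and is continuous, hence
    it preserves the domain and commutes with the generator. *)
Lemma cvg_generator_orbit g t : generator_domain P g -> 0 <= t ->
  h^-1 *: (P h (P t g) - P t g) @[h --> 0^'+] --> P t (generator P g).
Proof.
move=> gD t0.
have E : \forall h \near 0^'+, P t (h^-1 *: (P h g - g)) =
    h^-1 *: (P h (P t g) - P t g).
  near=> h; have h0 : 0 <= h by [].
  rewrite semigroupZ // semigroupB // -!(c0_add P_c0) //.
  by rewrite [t + h]addrC.
apply: cvg_trans (near_eq_cvg E) _.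
apply: cvg_semigroup => //; [exact: nearW|exact: cvg_cst].
Unshelve. all: by end_near. Qed.

Lemma generator_domain_orbit g t : generator_domain P g -> 0 <= t ->
  generator_domain P (P t g).
Proof.
move=> gD t0; rewrite /generator_domain /=.
by apply: cvgP; exact: cvg_generator_orbit.
Qed.

Lemma generator_orbit g t : generator_domain P g -> 0 <= t ->
  generator P (P t g) = P t (generator P g).
Proof. by move=> gD t0; apply: cvg_lim => //; exact: cvg_generator_orbit. Qed.

(** The generator only gives a right derivative at [0].  For [h] of either sign,
    factoring out the smaller of the times [t] and [t + h] writes the difference
    quotient at [t] as [P (min (h + t) t)] applied to the quotient at [0] with
    increment [`|h|]; joint continuity then gives the two-sided limit. *)
Lemma is_derive_orbit g t : generator_domain P g -> 0 < t ->
  is_derive t 1 (P ^~ g) (P t (generator P g)).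
Proof.
move=> gD t0; apply/is_derive1P.
pose D (h : R) := `|h|^-1 *: (P `|h| g - g).
have DA : D h @[h --> 0^'] --> generator P g.
  have gA : h^-1 *: (P h g - g) @[h --> 0^'+] --> generator P g by exact: gD.
  move=> A /gA [e /= e0 eA]; exists e => //= h /=.
  rewrite sub0r normrN => he h0; apply: eA => /=.
    by rewrite sub0r normrN normr_id.
  by rewrite normr_gt0.
have mt : Num.min (h + t) t @[h --> 0^'] --> t.
  apply/cvgrPdist_lt => e e0; near=> h.
  have : `|h| < e by near: h; exact: dnbhs0_lt.
  apply: le_lt_trans; rewrite minElt; case: ifP => _.
    by rewrite opprD addrCA subrr addr0 normrN.
  by rewrite subrr normr0.
have ht0 : \forall h \near 0^', 0 <= h + t.
  near=> h; have : `|h| < t by near: h; exact: dnbhs0_lt.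
  by rewrite ltr_norml => /andP[/ltW + _]; rewrite -subr_ge0 opprK.
have E : \forall h \near 0^', P (Num.min (h + t) t) (D h) =
    h^-1 *: (P (h + t) g - P t g).
  near=> h.
  have ht : 0 <= h + t by near: h.
  have [h0|h0] := ltP h 0.
    rewrite min_l; last by rewrite gerDr ltW.
    rewrite /D ltr0_norm // semigroupZ // semigroupB //.
    rewrite -(c0_add P_c0 ht) ?oppr_ge0 ?(ltW h0) //.
    rewrite -addrA [t - h]addrC addrA subrr add0r.
    by rewrite invrN scaleNr -scalerN opprB.
  rewrite min_r; last by rewrite lerDr.
  rewrite /D ger0_norm // semigroupZ ?(ltW t0) // semigroupB ?(ltW t0) //.
  rewrite -(c0_add P_c0 (ltW t0) h0).
  by rewrite [t + h]addrC.
apply: cvg_trans (near_eq_cvg E) _.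
apply: cvg_semigroup => //; first exact: ltW.
by apply: filterS ht0 => h ht; rewrite le_min ht ltW.
Unshelve. all: by end_near. Qed.

End semigroup.

(** * The conformable clock *)

Section clock.
Context {R : realType} (alpha : R) (alpha_gt0 : 0 < alpha).
Implicit Types s t : R.

(** The time change that vanishes at [0] and has conformable derivative [1]. *)
Definition conformable_clock (t : R) : R := t `^ alpha / alpha.

Lemma clock0 : conformable_clock 0 = 0.
Proof. by rewrite /conformable_clock powR0 ?mul0r // gt_eqF. Qed.

Lemma clock_ge0 t : 0 <= conformable_clock t.
Proof. by rewrite divr_ge0 ?powR_ge0 // ltW. Qed.

Lemma clock_gt0 t : 0 < t -> 0 < conformable_clock t.
Proof. by move=> t0; rewrite divr_gt0 ?powR_gt0. Qed.

Lemma le_clock s t : 0 <= s -> s <= t -> conformable_clock s <= conformable_clock t.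
Proof.
move=> s0 st; rewrite ler_pM2r ?invr_gt0 // (ge0_ler_powR (ltW alpha_gt0)) // nnegrE.
exact: le_trans st.
Qed.

Lemma lt_clock s t : 0 <= s -> s < t -> conformable_clock s < conformable_clock t.
Proof.
move=> s0 st; rewrite ltr_pM2r ?invr_gt0 // gt0_ltr_powR // nnegrE.
exact: le_trans (ltW st).
Qed.

Lemma is_derive_clock t : 0 < t ->
  is_derive t 1 conformable_clock (t `^ (1 - alpha))^-1.
Proof.
move=> t0; have dp := is_derive1_powR alpha t0.
have -> : (t `^ (1 - alpha))^-1 = alpha^-1 *: (alpha * t `^ (alpha - 1)).
  by rewrite -powRN opprB /GRing.scale /= mulKf // gt_eqF.
rewrite (_ : conformable_clock = alpha^-1 \*: (powR (R:=R) ^~ alpha)).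
  exact: is_deriveZ.
by apply/funext => x; rewrite /conformable_clock mulrC.
Qed.

(** Continuity at [0] is one-sided: [powR] extends to negative bases by the
    value [1], which leaves a jump there. *)
Lemma cvg_clock0 : conformable_clock t @[t --> 0^'+] --> conformable_clock 0.
Proof.
rewrite clock0 -[X in _ --> X](mul0r alpha^-1).
by apply: cvgM; [exact: powR_cvg0|exact: cvg_cst].
Qed.

Lemma cvg_clock t : 0 < t -> conformable_clock x @[x --> t] --> conformable_clock t.
Proof.
move=> t0; apply: (@is_derive1_cvg R R^o (conformable_clock : R -> R^o)).
exact: is_derive_clock.
Qed.

End clock.

(** * The conformable Cauchy problem *)

Section cauchy_problem.
Context {R : realType} {V : completeNormedModType R}.
Context (alpha : R) (alpha_gt0 : 0 < alpha).
Context (P : R -> V -> V) (P_c0 : c0_semigroup P) (P_bounded : bounded_semigroup P).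
Implicit Types (f g : V) (s t : R).

Local Notation phi := (conformable_clock alpha).

Lemma conformable_deriveP (u : R -> V) t l : 0 < t ->
  (conformable_derivable alpha u t /\ conformable_derive alpha u t = l) <->
  is_derive t 1 u ((t `^ (1 - alpha))^-1 *: l).
Proof.
move=> t0; have c0 : t `^ (1 - alpha) != 0 by rewrite gt_eqF // powR_gt0.
rewrite -(cvg_conformable_quotient alpha) // scalerKV //.
split=> [[du <-]//|ul].
by split; [apply: cvgP ul|apply: cvg_lim ul].
Qed.

Lemma clock_orbit_solution f : generator_domain P f ->
  conformable_solution alpha P f (fun t => P (phi t) f).
Proof.
move=> fD.
have sol t : 0 < t -> conformable_derivable alpha (fun t => P (phi t) f) t /\
    conformable_derive alpha (fun t => P (phi t) f) t = generator P (P (phi t) f).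
  move=> t0; apply/conformable_deriveP => //.
  rewrite generator_orbit ?clock_ge0 //.
  apply: (is_derive1_comp_curve (P ^~ f)); last exact: is_derive_clock.
  by apply: is_derive_orbit => //; exact: clock_gt0.
split=> [||t t0|t /sol[]//|t /sol[]//].
- apply/continuous_within_itvcyP; split=> [t|].
    rewrite in_itv /= andbT => t0; apply: cvg_semigroup => //.
    + exact: clock_ge0.
    + by apply: nearW => ?; exact: clock_ge0.
    + exact: cvg_clock.
    + exact: cvg_cst.
  apply: cvg_semigroup => //.
  + exact: clock_ge0.
  + by apply: nearW => ?; exact: clock_ge0.
  + exact: cvg_clock0.
  + exact: cvg_cst.
- by rewrite clock0 // (c0_id P_c0).
- by apply: generator_domain_orbit => //; exact: clock_ge0.
Qed.

(** Product rule for [s |-> P (phi T - phi s) (u s)].  Its increment splits into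
    the increment of [u], to which the operator at the displaced time is
    applied, and the increment of the orbit of the fixed vector [u s].  With
    [a = phi' s] the two parts converge to [P r (a *: generator P (u s))] and to
    [- a *: P r (generator P (u s))], where [r = phi T - phi s].  The condition
    [s < T] makes [r] positive, which leaves room for increments of both
    signs. *)
Lemma is_derive_reversed_clock (u : R -> V) (T s : R) :
  0 < s -> s < T -> generator_domain P (u s) ->
  is_derive s 1 u ((s `^ (1 - alpha))^-1 *: generator P (u s)) ->
  is_derive s 1 (fun s => P (phi T - phi s) (u s)) 0.
Proof.
move=> s0 sT uD du; set a := (s `^ (1 - alpha))^-1 in du *.
set v := generator P (u s) in du *.
have r0 : 0 < phi T - phi s by rewrite subr_gt0; apply: lt_clock => //; exact: ltW.
have dphi : is_derive s 1 phi a by exact: is_derive_clock.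
have dr : is_derive s 1 (fun s => phi T - phi s) (- a).
  by rewrite -[- a]add0r; exact: is_deriveB.
have cr : phi T - phi x @[x --> s] --> phi T - phi s.
  by apply: cvgB; [exact: cvg_cst|exact: cvg_clock].
have cr0 : phi T - phi (h + s) @[h --> 0^'] --> phi T - phi s.
  by apply: cvg_comp cr; exact: cvg_addr_dnbhs0.
have r_ge0 : \forall h \near 0^', 0 <= phi T - phi (h + s).
  exact: cvgr_ge cr0 _ r0.
have d1 : P (phi T - phi (h + s)) (h^-1 *: (u (h + s) - u s)) @[h --> 0^'] -->
    P (phi T - phi s) (a *: v).
  apply: (cvg_semigroup _ P_c0 P_bounded _ _ _ _ (ltW r0) r_ge0 cr0).
  exact/is_derive1P.
have d2 : h^-1 *: (P (phi T - phi (h + s)) (u s) - P (phi T - phi s) (u s))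
    @[h --> 0^'] -->
    - a *: P (phi T - phi s) v.
  apply/(is_derive1P (fun x => P (phi T - phi x) (u s))).
  apply: (is_derive1_comp_curve (P ^~ (u s))) dr.
  exact: is_derive_orbit.
apply/is_derive1P.
have := cvgD d1 d2.
rewrite semigroupZ ?(ltW r0) // -scalerDl subrr scale0r => d0.
have E : \forall h \near 0^',
    P (phi T - phi (h + s)) (h^-1 *: (u (h + s) - u s)) +
    h^-1 *: (P (phi T - phi (h + s)) (u s) - P (phi T - phi s) (u s)) =
    h^-1 *: (P (phi T - phi (h + s)) (u (h + s)) - P (phi T - phi s) (u s)).
  apply: filterS r_ge0 => h rh.
  by rewrite semigroupZ // semigroupB // -scalerDr addrA subrK.
exact: cvg_trans (near_eq_cvg E) (d0 _).
Qed.

(** The clock may fail to be differentiable at [0], and the equation is only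
    assumed for positive times; so the zero derivative of [w] is used on
    [`]0, T[] and the two ends are reached by continuity. *)
Lemma conformable_solution_unique f (u : R -> V) : conformable_solution alpha P f u ->
  forall t, 0 <= t -> u t = P (phi t) f.
Proof.
move=> usol T; rewrite le_eqVlt => /predU1P[<-|T0].
  by rewrite clock0 // (c0_id P_c0) (csol_init usol).
have /continuous_within_itvcyP[uc uc0] := csol_continuous usol.
have {}uc t : 0 < t -> u x @[x --> t] --> u t.
  by move=> t0; apply: uc; rewrite in_itv /= andbT.
pose w s := P (phi T - phi s) (u s).
have : w T = w 0.
  apply: (is_derive1_eq0_cst w T0) => [s|].
    rewrite in_itv /= => /andP[s0 sT]; apply: is_derive_reversed_clock => //.
      exact: (csol_domain usol).
    apply/conformable_deriveP => //.
    by split; [exact: (csol_derivable usol)|exact: (csol_eq usol)].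
  have cw (F : set_system R) (FF : Filter F) s : 0 <= s -> s <= T ->
      (\forall x \near F, 0 <= x <= T) ->
      phi x @[x --> F] --> phi s -> u x @[x --> F] --> u s -> w x @[x --> F] --> w s.
    move=> s0 sT F0T ps us; apply: cvg_semigroup => //.
    - by rewrite subr_ge0; exact: le_clock.
    - by apply: filterS F0T => x /andP[x0 xT]; rewrite subr_ge0; exact: le_clock.
    - by apply: cvgB => //; exact: cvg_cst.
  apply/continuous_within_itvP => //; split=> [s||].
  - rewrite in_itv /= => /andP[s0 sT]; apply: cw; rewrite ?ltW //.
    + near=> x; apply/andP; split; apply/ltW.
        by near: x; exact: lt_nbhsr.
      by near: x; exact: lt_nbhsl.
    + exact: cvg_clock.
    + exact: uc.
  - apply: cw => //; first exact: ltW.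
    + near=> x; apply/andP; split=> //.
      by near: x; exact: nbhs_right_le.
    + exact: cvg_clock0.
  - apply: cw => //; first exact: ltW.
    + near=> x; apply/andP; split=> //.
      by near: x; exact: nbhs_left_ge.
    + by apply: cvg_at_left_filter; exact: cvg_clock.
    + by apply: cvg_at_left_filter; exact: uc.
by rewrite /w subrr (c0_id P_c0) clock0 // subr0 (csol_init usol).
Unshelve. all: by end_near. Qed.

End cauchy_problem.

Theorem theorem3p1 (R : realType) (V : completeNormedModType R) (alpha : R)
    (P : R -> V -> V) (f : V)
    (alpha_gt0 : 0 < alpha) (alpha_lt1 : alpha < 1)
    (P_c0 : c0_semigroup P) (P_bounded : bounded_semigroup P)
    (f_dom : generator_domain P f) :
  [/\ conformable_solution alpha P f (fun t => P (t `^ alpha / alpha) f),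
      forall u : R -> V, conformable_solution alpha P f u ->
        forall t : R, 0 <= t -> u t = P (t `^ alpha / alpha) f
    & forall (d : measure_display) (E : measurableType d) (ev : V -> E -> R)
        (d' : measure_display) (Omega : measurableType d')
        (Pr : E -> probability Omega R) (X : R -> {mfun Omega >-> E}),
        function_space ev -> markov_semigroup ev P ->
        process_semigroup ev P Pr X ->
        forall u : R -> V, conformable_solution alpha P f u ->
        forall t : R, 0 <= t -> forall x,
          (ev (u t) x)%:E = ('E_(Pr x)[ev f \o X (t `^ alpha / alpha)%R])%E].
Proof.
have unique (u : R -> V) := @conformable_solution_unique R V alpha alpha_gt0 P
  P_c0 P_bounded f u.
split=> [|//|d E ev d' Omega Pr X _ _ PX u usol t t0 x].
- exact: clock_orbit_solution.
- rewrite (unique u usol t t0); apply: (process_repr PX).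
  exact: clock_ge0.
Qed.
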